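(* Let $H_1:\mathbb{R}^2\to\mathbb{R}$ be a proper harmonic function and let $d,\alpha\in\mathbb{N}$. Suppose that for every $i\in\mathbb{N}$ neither $\partial_x^iH_1$ nor $\partial_y^iH_1$ vanishes identically. Then the function $f_{d,\alpha}:\mathbf{Nil}\to\mathbb{R}$ given by $$f_{d,\alpha}(x,y,t)=H_1(x,y)\cdot x^d\cdot t^{\alpha}$$ is $(2\alpha+d+1)$-harmonic.
   Context: $\mathbb{N}$ denotes the natural numbers including $0$. $\mathbf{Nil}$ is the Riemannian manifold $\mathbb{R}^3$ with global coordinates $(x,y,t)$ and metric $ds^2=dx^2+dy^2+(dt-x\,dy)^2$. Its Laplace-Beltrami operator, acting on smooth complex-valued functions, is $$\tau(f)=\frac{\partial^2 f}{\partial x^2}+\frac{\partial^2 f}{\partial y^2}+2x\,\frac{\partial^2 f}{\partial y\partial t}+(1+x^2)\,\frac{\partial^2 f}{\partial t^2}.$$ On a Riemannian manifold with Laplace-Beltrami operator $\tau$, put $\tau^0(f)=f$ and $\tau^r(f)=\tau(\tau^{r-1}(f))$. For $r\ge1$, a smooth function $f$ is $r$-harmonic if $\tau^r(f)=0$ identically, and proper $r$-harmonic if moreover $\tau^{r-1}(f)$ does not vanish identically. A function $H_1$ on the Euclidean plane $\mathbb{R}^2$ is proper harmonic if it is proper $1$-harmonic, i.e. $\frac{\partial^2 H_1}{\partial x^2}+\frac{\partial^2 H_1}{\partial y^2}=0$ and $H_1$ does not vanish identically. *)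

(* Defs.v *)
From HB Require Import structures.
From mathcomp Require Import all_boot all_order all_algebra.
From mathcomp Require Import all_classical all_reals all_analysis.
Set Implicit Arguments.
Unset Strict Implicit.
Unset Printing Implicit Defensive.
Import Order.TTheory GRing.Theory Num.Theory.
Import numFieldNormedType.Exports.
Local Open Scope ring_scope.

Definition partial (R : realType) (n : nat) (i : 'I_n) (f : 'rV[R]_n -> R) :
    'rV[R]_n -> R :=
  fun p => 'D_(delta_mx 0 i) f p.

(* ['D_v f p] is a total operator, so the existence of each partial derivative
   has to be required explicitly. *)
Fixpoint Ck (R : realType) (n k : nat) (f : 'rV[R]_n -> R) : Prop :=
  if k is k'.+1 then
    continuous f /\
    forall i : 'I_n, (forall p, derivable f p (delta_mx 0 i)) /\
                     Ck k' (partial i f)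
  else continuous f.

Definition smooth (R : realType) (n : nat) (f : 'rV[R]_n -> R) : Prop :=
  forall k, Ck k f.

Definition vanishes (T : Type) (R : realType) (f : T -> R) : Prop :=
  forall p, f p = 0.

Definition r_harmonic (R : realType) (n : nat)
    (tau : ('rV[R]_n -> R) -> 'rV[R]_n -> R) (r : nat) (f : 'rV[R]_n -> R) :
    Prop :=
  [/\ (1 <= r)%N, smooth f & vanishes (iter r tau f)].

Definition proper_r_harmonic (R : realType) (n : nat)
    (tau : ('rV[R]_n -> R) -> 'rV[R]_n -> R) (r : nat) (f : 'rV[R]_n -> R) :
    Prop :=
  r_harmonic tau r f /\ ~ vanishes (iter r.-1 tau f).

Definition plane_laplacian (R : realType) (f : 'rV[R]_2 -> R) : 'rV[R]_2 -> R :=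
  fun p => partial 0 (partial 0 f) p + partial 1 (partial 1 f) p.

(* The Laplace-Beltrami operator of ds^2 = dx^2 + dy^2 + (dt - x dy)^2 on R^3,
   in the global coordinates (x, y, t) = (p 0 0, p 0 1, p 0 2). *)
Definition nil_laplacian (R : realType) (f : 'rV[R]_3 -> R) : 'rV[R]_3 -> R :=
  fun p =>
    partial 0 (partial 0 f) p + partial 1 (partial 1 f) p
    + 2 * p 0 0 * partial 1 (partial 2 f) p
    + (1 + p 0 0 ^+ 2) * partial 2 (partial 2 f) p.

Definition plane_point (R : realType) (x y : R) : 'rV[R]_2 :=
  \row_(j < 2) [:: x; y]`_j.

Definition nil_f (R : realType) (H : 'rV[R]_2 -> R) (d a : nat) : 'rV[R]_3 -> R :=
  fun p => H (plane_point (p 0 0) (p 0 1)) * p 0 0 ^+ d * p 0 2 ^+ a.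

(* Main.v *)
(** [nil_laplacian] sends [H x^d t^a], with [H] harmonic, to a combination of
    terms of the same shape, whose harmonic factor is [H] or a first partial
    derivative of [H] (harmonic again, as mixed partials commute), and whose
    weight [2 a + d] is strictly smaller. Hence [2 a + d + 1] applications
    annihilate it. *)
Require Import Defs.
From mathcomp Require Import all_boot all_order all_algebra.
From mathcomp Require Import all_classical all_reals all_analysis.
From mathcomp Require Import ring zify.
Set Implicit Arguments.
Unset Strict Implicit.
Unset Printing Implicit Defensive.
Import Order.TTheory GRing.Theory Num.Theory.
Import numFieldNormedType.Exports.
Local Open Scope ring_scope.

(** * Directional derivatives along lines and symmetry of mixed derivatives *)

(** Since [phi] maps the line through [x] affinely to the line through [phi x], both difference
    quotients are the same function of [h]. Derivability and derivatives then transfer by rewriting,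
    with information on [f] in the single direction [v'] only, where a chain rule would ask for full
    differentiability. *)
Lemma growth_rate_comp (R : numFieldType) (V V' W : normedModType R)
    (f : V' -> W) (phi : V -> V') (x v : V) (v' : V') :
  (forall h : R, phi (h *: v + x) = h *: v' + phi x) ->
  (fun h : R => h^-1 *: (((f \o phi) \o shift x) (h *: v) - (f \o phi) x)) =
  (fun h : R => h^-1 *: ((f \o shift (phi x)) (h *: v') - f (phi x))).
Proof. by move=> phiE; apply/funext => h /=; rewrite phiE. Qed.

Lemma derivable_comp_affine (R : numFieldType) (V V' W : normedModType R)
    (f : V' -> W) (phi : V -> V') (x v : V) (v' : V') :
  (forall h : R, phi (h *: v + x) = h *: v' + phi x) ->
  derivable f (phi x) v' -> derivable (f \o phi) x v.
Proof. by rewrite /derivable => /growth_rate_comp->. Qed.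

Lemma derive_comp_affine (R : numFieldType) (V V' W : normedModType R)
    (f : V' -> W) (phi : V -> V') (x v : V) (v' : V') :
  (forall h : R, phi (h *: v + x) = h *: v' + phi x) ->
  'D_v (f \o phi) x = 'D_v' f (phi x).
Proof. by rewrite /derive => /growth_rate_comp->. Qed.

Lemma MVT_line (R : realType) (V : normedModType R) (f : V -> R)
    (p v : V) (h : R) :
  0 < h -> (forall q, derivable f q v) ->
  exists2 s, 0 < s < h & f (h *: v + p) - f p = 'D_v f (s *: v + p) * h.
Proof.
move=> h0 df; pose l (s : R) := s *: v + p.
have lE s k : l (k *: 1 + s) = k *: v + l s.
  by rewrite /l scalerDl addrA [k *: 1]mulr1.
have dfl s : derivable (f \o l) s 1.
  by apply: derivable_comp_affine (lE s) (df _).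
have [||s] := @MVT R (f \o l) (fun s => 'D_v f (l s)) 0 h h0.
- move=> s _; split; first exact: dfl.
  exact: derive_comp_affine (lE s).
- exact: derivable_within_continuous.
by rewrite in_itv /= subr0 {2}/l scale0r add0r => s0h ->; exists s.
Qed.

(** The mean value theorem is used twice: in direction [u] for the increment
    [q |-> f (h *: v + q) - f q], then in direction [v] for ['D_u f], based at the intermediate
    point [s *: u + p]. *)
Lemma second_difference (R : realType) (V : normedModType R) (f : V -> R)
    (p u v : V) (h : R) :
  0 < h -> (forall q, derivable f q u) -> (forall q, derivable ('D_u f) q v) ->
  exists s t, [/\ 0 < s < h, 0 < t < h &
    f (h *: v + (h *: u + p)) - f (h *: u + p) - (f (h *: v + p) - f p) =
    'D_v ('D_u f) (t *: v + (s *: u + p)) * h * h].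
Proof.
move=> h0 dfu dfv; pose sh q := h *: v + q.
have shE q k : sh (k *: u + q) = k *: u + sh q by rewrite /sh addrCA.
have dsh q : derivable (f \o sh) q u.
  by apply: derivable_comp_affine (shE q) (dfu _).
have dg q : derivable (f \o sh - f) q u.
  by apply: derivableB.
have [s s0h gE] := MVT_line p h0 dg.
rewrite deriveB // (derive_comp_affine _ (shE _)) in gE.
have [t t0h DE] := MVT_line (s *: u + p) h0 dfv.
exists s, t; split=> //; rewrite -DE -gE //.
Qed.

(** Schwarz's theorem. The second difference is symmetric in [u] and [v], so it equals [h * h] times
    either mixed derivative, each taken at some point near [p]; continuity of both at [p] forces
    equality there. *)
Lemma derive_comm (R : realType) (V : normedModType R) (f : V -> R) (u v : V) :
  (forall q, derivable f q u) -> (forall q, derivable f q v) ->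
  (forall q, derivable ('D_u f) q v) -> (forall q, derivable ('D_v f) q u) ->
  continuous ('D_v ('D_u f)) -> continuous ('D_u ('D_v f)) ->
  'D_v ('D_u f) = 'D_u ('D_v f).
Proof.
move=> dfu dfv dfuv dfvu cuv cvu; apply/funext => p.
apply/eqP; rewrite -subr_eq0 -normr_le0.
apply/ler_addgt0Pl => e e0; rewrite addr0.
have e20 : 0 < e / 2 by rewrite divr_gt0.
have /cvgrPdist_lt /(_ _ e20) /nbhs_ballP [a /= a0 ha] := cuv p.
have /cvgrPdist_lt /(_ _ e20) /nbhs_ballP [b /= b0 hb] := cvu p.
pose m := Num.min a b.
have m0 : 0 < m by rewrite lt_min a0 b0.
(* The summand [1] keeps [N] positive even when [u] and [v] are both zero, and makes
   [h * (|u| + |v|)] strictly less than [m], so that all intermediate points stay in the ball of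
   radius [m]. *)
pose N := `|u| + `|v| + 1.
have N0 : 0 < N by rewrite ltr_wpDl // addr_ge0.
pose h := m / N.
have h0 : 0 < h by rewrite divr_gt0.
(* Stated for a pair [w], [z] so that it serves both orders of differentiation. *)
have near_p s t w z : 0 < s < h -> 0 < t < h -> `|w| + `|z| = `|u| + `|v| ->
    ball p m (t *: w + (s *: z + p)).
  move=> /andP[s0 sh] /andP[t0 th] wz.
  rewrite -ball_normE /= distrC addrA addrK.
  rewrite (le_lt_trans (ler_normD _ _)) // !normrZ !gtr0_norm //.
  apply: (@le_lt_trans _ _ (h * (`|u| + `|v|))).
    by rewrite -wz mulrDr lerD // ler_wpM2r // ltW.
  by rewrite /h mulrAC -mulrA gtr_pMr // ltr_pdivrMr // mul1r /N ltrDl.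
have [s [t [s0 t0 E1]]] := second_difference p h0 dfu dfuv.
have [s' [t' [s0' t0' E2]]] := second_difference p h0 dfv dfvu.
(* Both sides times [h * h] are the same second difference, with its two middle terms exchanged; the
   factor [h] is cancelled twice. *)
have E : 'D_v ('D_u f) (t *: v + (s *: u + p)) =
         'D_u ('D_v f) (t' *: u + (s' *: v + p)).
  apply: (mulIf (lt0r_neq0 h0)); apply: (mulIf (lt0r_neq0 h0)).
  have subrACA (a1 a2 a3 a4 : R) : a1 - a2 - (a3 - a4) = a1 - a3 - (a2 - a4).
    by ring.
  apply: etrans (esym E1) (etrans _ E2).
  by rewrite (addrCA (h *: v) (h *: u) p) subrACA.
have A : `|'D_v ('D_u f) p - 'D_v ('D_u f) (t *: v + (s *: u + p))| < e / 2.
  apply: ha; apply: le_ball (near_p s t v u s0 t0 (addrC _ _)).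
  by rewrite ge_min lexx.
have B : `|'D_u ('D_v f) p - 'D_u ('D_v f) (t' *: u + (s' *: v + p))| < e / 2.
  apply: hb; apply: le_ball (near_p s' t' u v s0' t0' erefl).
  by rewrite ge_min lexx orbT.
rewrite -E distrC in B.
rewrite (splitr e); apply: le_trans (ler_distD _ _ _) _.
by apply: lerD; apply: ltW; [exact: A|exact: B].
Qed.

(** * Algebra of [Ck] and smooth functions *)

Lemma CkS_Ck (R : realType) n k (f : 'rV[R]_n -> R) : Ck k.+1 f -> Ck k f.
Proof.
elim: k f => [|k IH] f [cf df] //; split=> // i.
by have [? ?] := df i; split=> //; apply: IH.
Qed.

Lemma partialD (R : realType) n (i : 'I_n) (f g : 'rV[R]_n -> R) :
  (forall p, derivable f p (delta_mx 0 i)) ->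
  (forall p, derivable g p (delta_mx 0 i)) ->
  partial i (f + g) = partial i f + partial i g.
Proof. by move=> df dg; apply/funext => p; rewrite /partial deriveD. Qed.

Lemma partialM (R : realType) n (i : 'I_n) (f g : 'rV[R]_n -> R) :
  (forall p, derivable f p (delta_mx 0 i)) ->
  (forall p, derivable g p (delta_mx 0 i)) ->
  partial i (f * g) = f * partial i g + g * partial i f.
Proof. by move=> df dg; apply/funext => p; rewrite /partial deriveM. Qed.

Lemma partial_cst (R : realType) n (i : 'I_n) (c : R) :
  partial i (cst c : 'rV[R]_n -> R) = cst 0.
Proof. by apply/funext => p; rewrite /partial derive_cst. Qed.

Lemma Ck_cst (R : realType) n k (c : R) : Ck k (cst c : 'rV[R]_n -> R).
Proof.
elim: k c => [|k IH] c; first exact: cst_continuous.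
split=> [|i]; first exact: cst_continuous.
by split=> [p|]; [exact: derivable_cst | rewrite partial_cst].
Qed.

Lemma CkD (R : realType) n k (f g : 'rV[R]_n -> R) :
  Ck k f -> Ck k g -> Ck k (f + g).
Proof.
elim: k f g => [|k IH] f g.
  by move=> /= cf cg p; exact: (continuousD (cf p) (cg p)).
move=> [cf df] [cg dg]; split=> [p|i]; first exact: (continuousD (cf p) (cg p)).
have [[dfi fi] [dgi gi]] := (df i, dg i).
by split=> [p|]; [exact: derivableD | rewrite partialD //; apply: IH].
Qed.

Lemma CkM (R : realType) n k (f g : 'rV[R]_n -> R) :
  Ck k f -> Ck k g -> Ck k (f * g).
Proof.
elim: k f g => [|k IH] f g.
  by move=> /= cf cg p; exact: (continuousM (cf p) (cg p)).
move=> Cf Cg; have [[cf df] [cg dg]] := (Cf, Cg).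
split=> [p|i]; first exact: (continuousM (cf p) (cg p)).
have [[dfi fi] [dgi gi]] := (df i, dg i).
split=> [p|]; first exact: derivableM.
(* The product rule leaves [f] and [g] themselves as factors, and these have to be lowered from
   order [k.+1] to [k]. *)
by rewrite partialM //; apply: CkD; apply: IH => //; apply: CkS_Ck.
Qed.

Lemma smooth_derivable (R : realType) n (i : 'I_n) (f : 'rV[R]_n -> R) p :
  smooth f -> derivable f p (delta_mx 0 i).
Proof. by move=> /(_ 1%N) [_ /(_ i) []]. Qed.

Lemma smooth_continuous (R : realType) n (f : 'rV[R]_n -> R) :
  smooth f -> continuous f.
Proof. by move=> /(_ 0%N). Qed.

Lemma smooth_partial (R : realType) n (i : 'I_n) (f : 'rV[R]_n -> R) :
  smooth f -> smooth (partial i f).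
Proof. by move=> sf k; have [_ /(_ i) []] := sf k.+1. Qed.

Lemma smooth_cst (R : realType) n (c : R) : smooth (cst c : 'rV[R]_n -> R).
Proof. by move=> k; apply: Ck_cst. Qed.

Lemma smoothD (R : realType) n (f g : 'rV[R]_n -> R) :
  smooth f -> smooth g -> smooth (f + g).
Proof. by move=> sf sg k; apply: CkD. Qed.

Lemma smoothM (R : realType) n (f g : 'rV[R]_n -> R) :
  smooth f -> smooth g -> smooth (f * g).
Proof. by move=> sf sg k; apply: CkM. Qed.

Lemma smoothX (R : realType) n (f : 'rV[R]_n -> R) m :
  smooth f -> smooth (f ^+ m).
Proof.
move=> sf; elim: m => [|m IH]; first exact: smooth_cst.
by rewrite exprS; apply: smoothM.
Qed.

Lemma smooth_scale (R : realType) n (c : R) (f : 'rV[R]_n -> R) :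
  smooth f -> smooth (c \*o f).
Proof. exact: (smoothM (@smooth_cst R n c)). Qed.

Lemma partial_scale (R : realType) n (i : 'I_n) (c : R) (f : 'rV[R]_n -> R) :
  smooth f -> partial i (c \*o f) = c \*o partial i f.
Proof.
move=> sf; apply/funext => p.
by rewrite /partial deriveMl //; apply: smooth_derivable.
Qed.

Lemma partial_comm (R : realType) n (i j : 'I_n) (f : 'rV[R]_n -> R) :
  smooth f -> partial i (partial j f) = partial j (partial i f).
Proof.
move=> sf; have sfi := smooth_partial i sf; have sfj := smooth_partial j sf.
apply: (@derive_comm R _ f (delta_mx 0 j) (delta_mx 0 i)) => [q|q|q|q||].
- exact: smooth_derivable.
- exact: smooth_derivable.
- exact: (smooth_derivable sfj).
- exact: (smooth_derivable sfi).
- exact: (smooth_continuous (smooth_partial i sfj)).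
- exact: (smooth_continuous (smooth_partial j sfi)).
Qed.

(** * Coordinate functions *)

Definition coord (R : realType) n (i : 'I_n) : 'rV[R]_n -> R := fun p => p 0 i.

Lemma derivable_coord (R : realType) n (i j : 'I_n) (p : 'rV[R]_n) :
  derivable (coord j) p (delta_mx 0 i).
Proof. by apply/diff_derivable/differentiable_coord. Qed.

Lemma partial_coord (R : realType) n (i j : 'I_n) :
  partial i (@coord R n j) = cst ((j == i)%:R).
Proof.
apply/funext => p.
(* The constant is read as the derivative of the identity of [R] in direction [(j == i)%:R], which
   is how [coord j] moves along the [i]-th axis. *)
rewrite /partial -[RHS](@derive_id R R (coord j p) (j == i)%:R).
apply: (@derive_comp_affine R _ _ _ id (coord j)) => h.
by rewrite /coord !mxE eqxx.
Qed.

Lemma smooth_coord (R : realType) n (j : 'I_n) : smooth (@coord R n j).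
Proof.
case=> [|k]; first exact: coord_continuous.
split=> [|i]; first exact: coord_continuous.
split=> [p|]; first exact: derivable_coord.
by rewrite partial_coord; apply: Ck_cst.
Qed.

(** * Pullback of functions of the plane along the projection forgetting [t] *)

Definition plane_proj (R : realType) (p : 'rV[R]_3) : 'rV[R]_2 :=
  plane_point (p 0 0) (p 0 1).

Lemma plane_projP (R : realType) (h : R) (v p : 'rV[R]_3) :
  plane_proj (h *: v + p) = h *: plane_proj v + plane_proj p.
Proof. by apply/rowP => -[[|[|//]] lt_j]; rewrite !mxE. Qed.

Lemma plane_proj_x (R : realType) :
  plane_proj (delta_mx 0 0) = delta_mx 0 0 :> 'rV[R]_2.
Proof. by apply/rowP => -[[|[|//]] lt_j]; rewrite !mxE. Qed.

Lemma plane_proj_y (R : realType) :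
  plane_proj (delta_mx 0 1) = delta_mx 0 1 :> 'rV[R]_2.
Proof. by apply/rowP => -[[|[|//]] lt_j]; rewrite !mxE. Qed.

Lemma plane_proj_t (R : realType) :
  plane_proj (delta_mx 0 2) = 0 :> 'rV[R]_2.
Proof. by apply/rowP => -[[|[|//]] lt_j]; rewrite !mxE. Qed.

Lemma plane_proj_continuous (R : realType) : continuous (@plane_proj R).
Proof.
(* A neighbourhood of a row vector contains a box, given by one neighbourhood [P i j] per entry, so
   it suffices to treat the two entries separately. *)
move=> p A [P nP PA].
have near_j j : nbhs p [set q | P 0 j (plane_proj q 0 j)]%classic.
  apply: (_ : {for p, continuous (fun q => plane_proj q 0 j)}) (nP 0 j).
  case: j => -[|[|//]] lt_j.
    rewrite (_ : (fun q => _) = (fun q : 'rV[R]_3 => q 0 0)).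
      exact: coord_continuous.
    by apply/funext => q; rewrite mxE.
  rewrite (_ : (fun q => _) = (fun q : 'rV[R]_3 => q 0 1)).
    exact: coord_continuous.
  by apply/funext => q; rewrite mxE.
rewrite /= nbhs_simpl /=.
apply: filterS (filterI (near_j 0) (near_j 1)) => q [q0 q1].
apply: PA => i j.
rewrite ord1; case: j => -[|[|//]] lt_j.
  by rewrite (_ : Ordinal lt_j = 0) //; apply: val_inj.
by rewrite (_ : Ordinal lt_j = 1) //; apply: val_inj.
Qed.

Lemma derivable_plane_proj (R : realType) (H : 'rV[R]_2 -> R) (i : 'I_3) p :
  smooth H -> derivable (H \o @plane_proj R) p (delta_mx 0 i).
Proof.
move=> sH; apply: (derivable_comp_affine (fun h => plane_projP h _ _)).
case: i => -[|[|[|//]]] lt_i.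
- rewrite (_ : Ordinal lt_i = 0); last exact: val_inj.
  by rewrite plane_proj_x; apply: smooth_derivable.
- rewrite (_ : Ordinal lt_i = 1); last exact: val_inj.
  by rewrite plane_proj_y; apply: smooth_derivable.
- rewrite (_ : Ordinal lt_i = 2); last exact: val_inj.
  by rewrite plane_proj_t; apply: derivable0.
Qed.

Lemma partial_x_plane_proj (R : realType) (H : 'rV[R]_2 -> R) :
  partial 0 (H \o @plane_proj R) = partial 0 H \o @plane_proj R.
Proof.
apply/funext => p; rewrite /partial /=.
by rewrite (derive_comp_affine H (fun h => plane_projP h _ _)) plane_proj_x.
Qed.

Lemma partial_y_plane_proj (R : realType) (H : 'rV[R]_2 -> R) :
  partial 1 (H \o @plane_proj R) = partial 1 H \o @plane_proj R.
Proof.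
apply/funext => p; rewrite /partial /=.
by rewrite (derive_comp_affine H (fun h => plane_projP h _ _)) plane_proj_y.
Qed.

Lemma partial_t_plane_proj (R : realType) (H : 'rV[R]_2 -> R) :
  partial 2 (H \o @plane_proj R) = cst 0.
Proof.
apply/funext => p; rewrite /partial /=.
rewrite (derive_comp_affine H (fun h => plane_projP h _ _)).
by rewrite plane_proj_t derive0.
Qed.

(** The induction on the order is over all smooth [H]: the [x] and [y] derivatives of a pullback are
    pullbacks of partial derivatives of [H], and the [t] derivative is zero. *)
Lemma smooth_plane_proj (R : realType) (H : 'rV[R]_2 -> R) :
  smooth H -> smooth (H \o @plane_proj R).
Proof.
have cont K : smooth K -> continuous (K \o @plane_proj R).
  move=> sK p; apply: continuous_comp; first exact: plane_proj_continuous.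
  exact: smooth_continuous.
move=> sH k; elim: k H sH => [|k IH] H sH; first exact: cont.
split=> [|i]; first exact: cont.
split=> [p|]; first exact: derivable_plane_proj.
case: i => -[|[|[|//]]] lt_i.
- rewrite (_ : Ordinal lt_i = 0); last exact: val_inj.
  by rewrite partial_x_plane_proj; apply: IH; apply: smooth_partial.
- rewrite (_ : Ordinal lt_i = 1); last exact: val_inj.
  by rewrite partial_y_plane_proj; apply: IH; apply: smooth_partial.
- rewrite (_ : Ordinal lt_i = 2); last exact: val_inj.
  by rewrite partial_t_plane_proj; apply: Ck_cst.
Qed.

(** * Derivatives and Laplacian of the functions [nil_f] *)

Lemma nil_fE (R : realType) (H : 'rV[R]_2 -> R) d a :
  nil_f H d a = (H \o @plane_proj R) * (@coord R 3 0 ^+ d * @coord R 3 2 ^+ a).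
Proof. by apply/funext => p; rewrite /nil_f !fctE /= mulrA. Qed.

Lemma smooth_nil_f (R : realType) (H : 'rV[R]_2 -> R) d a :
  smooth H -> smooth (nil_f H d a).
Proof.
move=> sH; rewrite nil_fE; apply: smoothM; first exact: smooth_plane_proj.
by apply: smoothM; apply: smoothX; apply: smooth_coord.
Qed.

(** The truncated exponent [m.-1] is harmless at [m = 0], where the factor [m%:R] is zero. All later
    formulas with [d.-1], [d.-2], [a.-1] and [a.-2] rely on such vanishing coefficients. *)
Lemma partial_coordX (R : realType) n (i j : 'I_n) m :
  partial i (@coord R n j ^+ m) =
  fun p => m%:R * p 0 j ^+ m.-1 * (j == i)%:R.
Proof.
apply/funext => p; rewrite /partial deriveX; last exact: derivable_coord.
by rewrite -/(partial i (@coord R n j) p) partial_coord.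
Qed.

Lemma partial_nil_f (R : realType) (H : 'rV[R]_2 -> R) d a (i : 'I_3) p :
  smooth H ->
  partial i (nil_f H d a) p =
  partial i (H \o @plane_proj R) p * (p 0 0 ^+ d * p 0 2 ^+ a) +
  H (plane_proj p) * (d%:R * p 0 0 ^+ d.-1 * (0 == i)%:R * p 0 2 ^+ a +
                      p 0 0 ^+ d * (a%:R * p 0 2 ^+ a.-1 * (2 == i)%:R)).
Proof.
move=> sH; have sx := smoothX d (@smooth_coord R 3 0).
have st := smoothX a (@smooth_coord R 3 2).
rewrite nil_fE partialM; first last.
- by move=> q; apply: smooth_derivable; apply: smoothM.
- by move=> q; apply: derivable_plane_proj.
rewrite partialM; first last.
- by move=> q; apply: smooth_derivable.
- by move=> q; apply: smooth_derivable.
rewrite !partial_coordX !fctE /= /coord.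
ring.
Qed.

Lemma partial_x_nil_f (R : realType) (H : 'rV[R]_2 -> R) d a :
  smooth H ->
  partial 0 (nil_f H d a) = nil_f (partial 0 H) d a + d%:R \*o nil_f H d.-1 a.
Proof.
move=> sH; apply/funext => p.
rewrite partial_nil_f // partial_x_plane_proj /nil_f !fctE /= /plane_proj.
ring.
Qed.

Lemma partial_y_nil_f (R : realType) (H : 'rV[R]_2 -> R) d a :
  smooth H -> partial 1 (nil_f H d a) = nil_f (partial 1 H) d a.
Proof.
move=> sH; apply/funext => p.
rewrite partial_nil_f // partial_y_plane_proj /nil_f !fctE /= /plane_proj.
ring.
Qed.

Lemma partial_t_nil_f (R : realType) (H : 'rV[R]_2 -> R) d a :
  smooth H -> partial 2 (nil_f H d a) = a%:R \*o nil_f H d a.-1.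
Proof.
move=> sH; apply/funext => p.
rewrite partial_nil_f // partial_t_plane_proj /nil_f !fctE /= /plane_proj.
ring.
Qed.

(** The first two terms come from differentiating twice in [x], the third from the mixed term [2 x]
    times the [y], [t] derivative, the last two from [1 + x ^+ 2]. Where the coefficients are
    nonzero, the weight [2 * a + d] drops by 1, 2, 1, 4 and 2 respectively. *)
Lemma nil_laplacian_nil_f (R : realType) (H : 'rV[R]_2 -> R) d a :
  smooth H -> vanishes (plane_laplacian H) ->
  nil_laplacian (nil_f H d a) =
  (2 * d%:R) \*o nil_f (partial 0 H) d.-1 a +
  ((d%:R * d.-1%:R) \*o nil_f H d.-2 a +
  ((2 * a%:R) \*o nil_f (partial 1 H) d.+1 a.-1 +
  ((a%:R * a.-1%:R) \*o nil_f H d a.-2 +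
   (a%:R * a.-1%:R) \*o nil_f H d.+2 a.-2))).
Proof.
move=> sH harmH; apply/funext => p.
have sHx := smooth_partial 0 sH; have sHy := smooth_partial 1 sH.
have sm (K : 'rV[R]_2 -> R) e b i : smooth K ->
    forall q, derivable (nil_f K e b) q (delta_mx 0 i).
  by move=> sK q; apply: smooth_derivable; apply: smooth_nil_f.
have smZ (K : 'rV[R]_2 -> R) c e b i : smooth K ->
    forall q, derivable (c \*o nil_f K e b) q (delta_mx 0 i).
  by move=> sK q; apply: smooth_derivable; apply/smooth_scale/smooth_nil_f.
rewrite /nil_laplacian partial_x_nil_f // partialD; [|exact: sm|exact: smZ].
rewrite partial_scale; last exact: smooth_nil_f.
rewrite !partial_x_nil_f // !partial_y_nil_f // !partial_t_nil_f //.
rewrite !partial_scale; do ?exact: smooth_nil_f.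
rewrite partial_y_nil_f // partial_t_nil_f //.
(* Harmonicity expresses the pure second [x] derivative of [H] as minus the [y] one, which cancels
   the two terms that would keep the weight unchanged. *)
have /eqP := harmH (plane_point (p 0 0) (p 0 1)).
rewrite /plane_laplacian addr_eq0 => /eqP harm.
rewrite !fctE /nil_f /= harm !exprS.
ring.
Qed.

(** * Linearity of the Laplacian and functions annihilated by its iterates *)

Lemma smooth_nil_laplacian (R : realType) (f : 'rV[R]_3 -> R) :
  smooth f -> smooth (nil_laplacian f).
Proof.
move=> sf; have s2 i j : smooth (partial i (partial j f)).
  by do 2 apply: smooth_partial.
have -> : nil_laplacian f =
    partial 0 (partial 0 f) + partial 1 (partial 1 f)
    + (cst 2 * @coord R 3 0) * partial 1 (partial 2 f)
    + (cst 1 + @coord R 3 0 ^+ 2) * partial 2 (partial 2 f).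
  by apply/funext => p; rewrite !fctE.
have [sx s1] := (@smooth_coord R 3 0, @smooth_cst R 3).
apply: smoothD; first apply: smoothD; first exact: smoothD.
  by apply: smoothM => //; apply: smoothM.
by apply: smoothM => //; apply: smoothD => //; apply: smoothX.
Qed.

Lemma nil_laplacianD (R : realType) (f g : 'rV[R]_3 -> R) :
  smooth f -> smooth g ->
  nil_laplacian (f + g) = nil_laplacian f + nil_laplacian g.
Proof.
move=> sf sg; apply/funext => p.
have dD i (u v : 'rV[R]_3 -> R) : smooth u -> smooth v ->
    partial i (u + v) = partial i u + partial i v.
  by move=> su sv; apply: partialD => q; apply: smooth_derivable.
have s1 i (u : 'rV[R]_3 -> R) : smooth u -> smooth (partial i u).
  exact: smooth_partial.
have ddD i j : partial i (partial j (f + g)) p =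
    partial i (partial j f) p + partial i (partial j g) p.
  by rewrite (dD j f g sf sg) (dD i _ _ (s1 j f sf) (s1 j g sg)).
rewrite {1}/nil_laplacian (ddD 0 0) (ddD 1 1) (ddD 1 2) (ddD 2 2).
rewrite /nil_laplacian -[RHS]/(_ + _) !mulrDr.
by rewrite [X in X + _ + _]addrACA [X in X + _]addrACA [LHS]addrACA.
Qed.

Lemma nil_laplacian_scale (R : realType) (c : R) (f : 'rV[R]_3 -> R) :
  smooth f -> nil_laplacian (c \*o f) = c \*o nil_laplacian f.
Proof.
move=> sf; apply/funext => p.
have s1 i : smooth (partial i f) by exact: smooth_partial.
rewrite /nil_laplacian !partial_scale //=.
have scaleE (a1 a2 a3 a4 x : R) : c * a1 + c * a2 + 2 * x * (c * a3) +
    (1 + x ^+ 2) * (c * a4) = c * (a1 + a2 + 2 * x * a3 + (1 + x ^+ 2) * a4).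
  by ring.
exact: scaleE.
Qed.

(** Smoothness is bundled in because the linearity of [nil_laplacian] is established for smooth
    functions. Unlike in [r_harmonic], [n = 0] is allowed, so that an induction can start from the
    zero function. *)
Definition killed (R : realType) (n : nat) (f : 'rV[R]_3 -> R) : Prop :=
  smooth f /\ vanishes (iter n (@nil_laplacian R) f).

Lemma killedS (R : realType) n (f : 'rV[R]_3 -> R) :
  smooth f -> killed n (nil_laplacian f) -> killed n.+1 f.
Proof. by move=> sf [_ kf]; split=> // p; rewrite iterSr. Qed.

Lemma killedD (R : realType) n (f g : 'rV[R]_3 -> R) :
  killed n f -> killed n g -> killed n (f + g).
Proof.
move=> [sf kf] [sg kg]; split; first exact: smoothD.
elim: n f g sf sg kf kg => [|n IH] f g sf sg kf kg p.
  by have := kg p; have := kf p => /= fp0 gp0; rewrite fctE fp0 gp0 addr0.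
move: p; rewrite iterSr nil_laplacianD //.
apply: IH; do ?[exact: smooth_nil_laplacian].
  by move=> p; have := kf p; rewrite iterSr.
by move=> p; have := kg p; rewrite iterSr.
Qed.

(** The condition on [f] is asked only for [c != 0]: in the Laplacian of [nil_f H d a], a term with
    zero coefficient may have a weight that does not drop, such as the one in [d.+1] and [a.-1] when
    [a = 0]. *)
Lemma killed_scale (R : realType) n (c : R) (f : 'rV[R]_3 -> R) :
  smooth f -> (c != 0 -> killed n f) -> killed n (c \*o f).
Proof.
move=> sf kf; split; first exact: smooth_scale.
(* As a disjunction the hypothesis survives the induction, in which [f] is replaced by its Laplacian
   while [c] stays fixed. *)
have {}kf : c = 0 \/ vanishes (iter n (@nil_laplacian R) f).
  by have [|/kf[]] := eqVneq c 0; [left | right].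
elim: n f sf kf => [|n IH] f sf kf p.
  by case: kf => /= [->|->]; rewrite ?mul0r ?mulr0.
move: p; rewrite iterSr nil_laplacian_scale //.
apply: IH; first exact: smooth_nil_laplacian.
by case: kf => kf; [left | right => p; have := kf p; rewrite iterSr].
Qed.

(** * Harmonicity of partial derivatives and descent on the weight *)

Lemma plane_laplacian_partial (R : realType) (H : 'rV[R]_2 -> R) i :
  smooth H -> vanishes (plane_laplacian H) ->
  vanishes (plane_laplacian (partial i H)).
Proof.
move=> sH harmH p.
have s1 j : smooth (partial j H) by exact: smooth_partial.
have s2 j : smooth (partial j (partial j H)) by exact: smooth_partial.
(* Two exchanges bring [partial i] to the outside, so the Laplacian of [partial i H] is [partial i]
   of the zero function. *)
have swap j :
    partial j (partial j (partial i H)) = partial i (partial j (partial j H)).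
  by rewrite (partial_comm j i sH) (partial_comm j i (s1 j)).
have D : partial i (partial 0 (partial 0 H) + partial 1 (partial 1 H)) p =
    partial i (partial 0 (partial 0 H)) p +
    partial i (partial 1 (partial 1 H)) p.
  by rewrite partialD // => q; apply: smooth_derivable.
have E0 : partial 0 (partial 0 H) + partial 1 (partial 1 H) = cst 0.
  by apply/funext => q; apply: harmH.
rewrite /plane_laplacian (swap 0) (swap 1).
by apply: etrans (esym D) _; rewrite E0 partial_cst.
Qed.

Lemma killed_nil_f (R : realType) n (H : 'rV[R]_2 -> R) d a :
  smooth H -> vanishes (plane_laplacian H) -> (2 * a + d < n)%N ->
  killed n (nil_f H d a).
Proof.
elim: n H d a => [//|n IH] H d a sH harmH lt_n.
have sHi i := smooth_partial i sH.
have harmHi i := plane_laplacian_partial i sH harmH.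
(* The coefficient is a natural number, so that the bound on the weight may assume [0 < c]; this
   rules out the cases in which a predecessor is truncated. *)
have killed_term (c : nat) (K : 'rV[R]_2 -> R) e b :
    smooth K -> vanishes (plane_laplacian K) ->
    ((0 < c)%N -> (2 * b + e < n)%N) -> killed n (c%:R \*o nil_f K e b).
  move=> sK harmK lt_eb; apply: killed_scale; first exact: smooth_nil_f.
  by rewrite pnatr_eq0 -lt0n => /lt_eb; exact: IH.
apply: killedS; first exact: smooth_nil_f.
(* Gathering each coefficient into one cast of a natural number gives the terms the shape expected
   by [killed_term], and leaves inequalities of linear arithmetic. *)
rewrite nil_laplacian_nil_f // -!natrM.
apply: killedD.
  by apply: killed_term (sHi 0) (harmHi 0) _; clear -lt_n; lia.
apply: killedD.
  by apply: killed_term sH harmH _; clear -lt_n; lia.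
apply: killedD.
  by apply: killed_term (sHi 1) (harmHi 1) _; clear -lt_n; lia.
by apply: killedD; apply: killed_term sH harmH _; clear -lt_n; lia.
Qed.

Theorem theorem1p2 (R : realType) (H1 : 'rV[R]_2 -> R) (d alpha : nat)
    (H1_harmonic : proper_r_harmonic (@plane_laplacian R) 1 H1)
    (H1_derivatives : forall i : nat,
       ~ vanishes (iter i (partial 0) H1) /\ ~ vanishes (iter i (partial 1) H1)) :
  r_harmonic (@nil_laplacian R) (2 * alpha + d + 1)%N (nil_f H1 d alpha).
Proof.
have [[_ sH harmH] _] := H1_harmonic.
have [sf kf] : killed (2 * alpha + d + 1) (nil_f H1 d alpha).
  (* The strict bound on the weight accounts for the final [+ 1]. *)
  by apply: killed_nil_f => //; rewrite addn1.
by split; rewrite // addn1.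
Qed.
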